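(* Let $Y\subset 2^\omega\setminus Q$ be a saturated $\lambda'$-set. Then $X=\mathbb{A}(Y)$ is a compact linearly ordered countable dense homogeneous space of weight $|Y|$.
   Context: $2^\omega$ is the Cantor set of infinite binary sequences, ordered lexicographically (its order topology is the usual product topology). For $i\in\{0,1\}$ let $Q_i=\{x\in 2^\omega:\exists n<\omega\ \forall m\ge n\ (x(m)=i)\}$, and $Q=Q_0\cup Q_1$. For $Y\subset 2^\omega\setminus Q$, $\mathbb{A}(Y)$ is the set $((2^\omega\setminus Q_0)\times\{0\})\cup((Q_0\cup Y)\times\{1\})$ with the order topology given by the lexicographic order (on pairs). A subset $Y$ of $2^\omega$ is a $\lambda'$-set if for every countable $Z\subseteq 2^\omega$, $Z$ is a relative $G_\delta$ subset of $Y\cup Z$. For $x,y\in 2^\omega$ write $x\sim y$ (tail equivalence) if there are $m,n\in\omega$ such that $x(m+k)=y(n+k)$ for all $k\in\omega$; $Y$ is saturated if $Y=\{y\in 2^\omega:\exists x\in Y\ (y\sim x)\}$. A separable topological space $X$ is countable dense homogeneous (CDH) if for any two countable dense subsets $D,E$ of $X$ there is a homeomorphism $f\colon X\to X$ with $f[D]=E$. The weight of a space is the least cardinality of a base for its topology.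
   Formalization: The claim that the weight is |Y| is stated only for nonempty Y, since for empty Y (which is saturated and a λ'-set) the space A(Y) is the Cantor set, of weight ω rather than 0; all other claims are stated for every Y. *)

(* Defs.v *)
From HB Require Import structures.
From mathcomp Require Import all_boot all_order.
From mathcomp Require Import wochoice boolp classical_sets functions cardinality.
From mathcomp Require Import topology cantor borel_hierarchy.

Set Implicit Arguments.
Unset Strict Implicit.
Unset Printing Implicit Defensive.

Import Order.TTheory.
Local Open Scope classical_set_scope.
Local Open Scope card_scope.

(* Strict lexicographic order of 2^omega, with false < true. *)
Definition cantor_ltb (x y : cantor_space) : bool :=
  `[< exists n, (forall m, (m < n)%N -> x m = y m) /\ ~~ x n && y n >].

Lemma cantor_ltb_irr x : cantor_ltb x x = false.
Proof. by apply/asboolPn => -[n [_]]; case: (x n). Qed.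

Lemma cantor_ltb_trans : transitive cantor_ltb.
Proof.
move=> y x z /asboolP[n [xy xyn]] /asboolP[k [yz yzk]]; apply/asboolP.
have [nk|kn|nk] := ltngtP n k.
- exists n; split=> [m mn|]; first by rewrite xy// yz// (ltn_trans mn).
  by rewrite -yz.
- exists k; split=> [m mk|]; first by rewrite xy ?yz// (ltn_trans mk).
  by rewrite xy.
- by move: xyn yzk; rewrite nk => /andP[_ ->].
Qed.

Lemma cantor_ltb_total x y : x != y -> cantor_ltb x y || cantor_ltb y x.
Proof.
move=> /eqP xNy.
have /existsNP[k /eqP xyk] : ~ forall n, x n = y n by move=> /funext.
have ex : exists n, x n != y n by exists k.
case: (ex_minnP ex) => n xyn nmin.
have xym m : (m < n)%N -> x m = y m.
  move=> mn; apply/eqP/negPn/negP => /nmin.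
  by rewrite leqNgt mn.
case xn: (x n) xyn; case yn: (y n) => // _; apply/orP; [right|left];
  by apply/asboolP; exists n; rewrite xn yn; split=> // m /xym.
Qed.

Fact cantor_display : Order.disp_t. Proof. exact: Order.Disp tt tt. Qed.

HB.instance Definition _ := Order.LtOrder.Build cantor_display cantor_space
  (fun _ _ => erefl) (fun _ _ => erefl) (fun _ _ => erefl)
  cantor_ltb_irr cantor_ltb_trans cantor_ltb_total.

Definition Qtail (i : bool) : set cantor_space :=
  [set x | exists n, forall m, (n <= m)%N -> x m = i].

Definition Qset : set cantor_space := Qtail false `|` Qtail true.

Definition tail_equiv (x y : cantor_space) : Prop :=
  exists m n, forall k, x (m + k) = y (n + k).

Definition saturated (Y : set cantor_space) : Prop :=
  Y = [set y | exists2 x, Y x & tail_equiv y x].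

Definition lambda'_set (Y : set cantor_space) : Prop :=
  forall Z : set cantor_space, countable Z ->
    exists2 G : set cantor_space, Gdelta G & Z = (Y `|` Z) `&` G.

Definition arrow_set (Y : set cantor_space) : set (cantor_space *l bool) :=
  ((~` Qtail false) `*` [set false]) `|` ((Qtail false `|` Y) `*` [set true]).

Definition arrow_order (Y : set cantor_space) : Type := set_type (arrow_set Y).

HB.instance Definition _ Y := SubChoice.on (arrow_order Y).
HB.instance Definition _ Y :=
  [SubChoice_isSubOrder of arrow_order Y by <: with cantor_display].

(* A(Y); unlike on arrow_set Y itself, the topology is that of the induced order. *)
Definition arrow_space (Y : set cantor_space) :
    orderTopologicalType cantor_display :=
  order_topology (arrow_order Y).

(* The topology of T is the order topology of some linear order: the open rays
   form a subbase. *)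
Definition linearly_ordered_space (T : topologicalType) : Prop :=
  exists2 R : rel T, total_order R &
    basis (finI_from [set: bool * T] (fun p =>
      if p.1 then [set x | ~~ R x p.2] else [set x | ~~ R p.2 x])).

Definition separable (T : topologicalType) : Prop :=
  exists2 D : set T, countable D & dense D.

Definition homeomorphism (S T : topologicalType) (f : S -> T) : Prop :=
  continuous f /\ exists g : T -> S, [/\ cancel f g, cancel g f & continuous g].

Definition countable_dense_homogeneous (T : topologicalType) : Prop :=
  separable T /\
  forall D E : set T, countable D -> dense D -> countable E -> dense E ->
    exists2 f : T -> T, homeomorphism f & f @` D = E.

(* The weight of T, the least cardinality of a base, equals the cardinality of A. *)
Definition weight_eq (T : topologicalType) U (A : set U) : Prop :=
  (exists2 B : set (set T), basis B & B #= A) /\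
  (forall B : set (set T), basis B -> A #<= B).

(* Main.v *)
(* Let pi : A(Y) -> 2^omega be the first projection.  The topology of A(Y) is
   generated by the cones pi^-1[s] and the clopen initial segments
   cut y = {q | q <= (y, 0)} for y in Y.  Tail shifts carry cones onto cones
   because Y is saturated, and every point has a neighbourhood that is the union
   of the point and a sequence of disjoint cones converging to it; hence two
   points of an open V can be exchanged by an involution supported in V which
   moves the other points within their tail classes.

   Given countable dense sets D and E, let Z be the countable union of the tail
   classes of pi[D] and pi[E].  The lambda'-property yields open sets O_n
   containing Z such that each y in Y \ Z avoids some O_n.  A back-and-forth
   construction composes such involutions, the n-th one with support so small
   that it splits neither the cones of length at most n, nor cut y for y outside
   some O_i with i <= n, nor cut z for z among the first n points of Z.  Thus
   the preimage of each generating clopen set is eventually constant, and by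
   compactness the compositions converge to a homeomorphism mapping D onto E. *)
Require Import Defs.
From mathcomp Require Import all_boot all_order.
From mathcomp Require Import finmap zify.
From mathcomp Require Import mathcomp_extra boolp classical_sets functions.
From mathcomp Require Import cardinality filter interval set_interval.
From mathcomp Require Import topology cantor borel_hierarchy.
Import Order.TTheory.
Local Open Scope classical_set_scope.
Local Open Scope card_scope.

Set Implicit Arguments.
Unset Strict Implicit.

(** * Back-and-forth with eventually constant preimages *)

Section BackAndForth.
Variables (T : topologicalType) (C : nat -> set (set T)) (W : set T).

(** The sequence of maps built below need not be eventually constant at any point; only the
    preimages of the sets in [C] stabilize, so agreement is measured on these preimages. *)
Definition agree (n : nat) (f g : T -> T) :=
  forall i A, (i <= n)%N -> C i A -> forall x, A (f x) <-> A (g x).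

Definition auto_pair (f f' : T -> T) :=
  [/\ continuous f, continuous f', cancel f f', cancel f' f
    & forall x, W (f x) <-> W x].

Hypotheses (Tcompact : compact [set: T]) (Thausdorff : hausdorff_space T).
Hypothesis Cclopen : forall n A, C n A -> clopen A.
Hypothesis Csep : forall p q, (forall n A, C n A -> A p <-> A q) -> p = q.
(** Near a point of [W] no set of level [n] splits a small enough neighbourhood, so a swap supported
    there leaves the preimages of that level unchanged. *)
Hypothesis Wdecides : forall n p, W p ->
  exists2 U, nbhs p U & forall A, C n A -> U `<=` A \/ U `<=` ~` A.
Hypothesis swap : forall p q V, W p -> W q -> open V -> V p -> V q ->
  exists g : T -> T, [/\ continuous g, cancel g g, g p = q,
    forall x, ~ V x -> g x = x & forall x, W (g x) <-> W x].

Lemma auto_pairC f f' : auto_pair f f' -> auto_pair f' f.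
Proof.
by move=> [fc f'c fK f'K fW]; split=> // x; rewrite -{2}(f'K x) fW.
Qed.

Lemma agree_trans n f g h : agree n f g -> agree n g h -> agree n f h.
Proof. by move=> fg gh i A ni CA x; rewrite (fg i)// (gh i). Qed.

Lemma agreeS m n f g : (m <= n)%N -> agree n f g -> agree m f g.
Proof. by move=> mn fg i A im CA x; apply: (fg i) => //; exact: leq_trans mn. Qed.

(** A cluster point of [F] lies in the same sets of [C] as [q], since these sets and their
    complements are closed; by [Csep] it is [q]. In a compact Hausdorff space a unique cluster point
    is a limit. *)
Lemma cvg_clopens (F : set_system T) q : ProperFilter F ->
  (forall n A, C n A -> A q -> F A) ->
  (forall n A, C n A -> ~ A q -> F (~` A)) -> F --> q.
Proof.
move=> FF Fin Fout.
have clq r : cluster F r -> r = q.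
  move=> Fr; apply: (@Csep r q) => n A CA.
  have clos B : F B -> closed B -> B r.
    by move=> FB Bcl; move: Fr; rewrite clusterE => /(_ _ FB); exact: Bcl.
  have [oA cA] := Cclopen CA; split; last first.
    by move=> Aq; apply: clos => //; exact: Fin CA Aq.
  apply: contraPP => nAq; apply: (clos (~` A)); first exact: Fout CA nAq.
  exact: open_closedC.
apply: (compact_cluster_set1 Thausdorff Tcompact) => //; try exact: filterT.
apply/seteqP; split=> [r /clq//|_ ->].
by have [r [_ Fr]] := Tcompact FF filterT; rewrite -(clq _ Fr).
Qed.

(** Take for [g x] a cluster point of the sequence [f n x]. Membership of [f n x] in a clopen set of
    level [i] is constant from stage [i] on, so the cluster point inherits it. *)
Lemma agree_limit (f : nat -> T -> T) :
  (forall n, agree n (f n) (f n.+1)) -> exists g, forall n, agree n (f n) g.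
Proof.
move=> fS; have fm m n : (n <= m)%N -> agree n (f n) (f m).
  elim: m => [|m IH]; first by rewrite leqn0 => /eqP ->.
  rewrite leq_eqVlt => /predU1P[->//|nm].
  by apply: (agree_trans (IH _)) => //; exact: agreeS (fS m).
suff /choice[g gP] : forall x, exists q, forall n A, C n A -> A (f n x) <-> A q.
  exists g => n i A ni CA x; rewrite -(gP x i A CA).
  by symmetry; exact: (fm n i ni i A).
move=> x; have [q [_ clq]] := Tcompact (fmap_proper_filter (f ^~ x)
  eventually_filter) filterT.
have clos (B : set T) n : closed B -> (forall m, (n <= m)%N -> B (f m x)) -> B q.
  move=> Bcl fB; move: clq; rewrite clusterE => /(_ B) qB; apply: Bcl.
  by apply: qB; exists n.
exists q => n A CA; have [oA cA] := Cclopen CA; split.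
  by move=> Af; apply: (clos _ n) => // m nm; apply/(fm m n nm n A).
apply: contraPP => nAf; apply: (clos (~` A) n); first exact: open_closedC.
by move=> m nm /(fm m n nm n A (leqnn _) CA).
Qed.

Lemma agree_homeomorphism (f f' : nat -> T -> T) (g g' : T -> T) :
  (forall n, auto_pair (f n) (f' n)) -> (forall n, agree n (f n) g) ->
  (forall n, agree n (f' n) g') -> continuous g /\ cancel g g'.
Proof.
move=> fa fg fg'.
have pre n A : C n A -> clopen (f n @^-1` A) /\ clopen (f' n @^-1` A).
  by move=> /Cclopen Acl; have [fc f'c _ _ _] := fa n;
    split; apply: preimage_clopen.
have cvgf x : f ^~ x @ \oo --> g x.
  apply: cvg_clopens => n A CA Ag; exists n => // m /= nm.
    by apply/(fg m n A).
  by move/(fg m n A nm CA).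
split=> [x|x].
  apply: cvg_clopens => n A CA Ag; have [[oA cA] _] := pre _ _ CA.
    have /= : nbhs x (f n @^-1` A).
      by apply: open_nbhs_nbhs; split=> //=; apply/(fg n n A).
    by apply: filterS => y /= /(fg n n A (leqnn _) CA).
  have /= : nbhs x (f n @^-1` (~` A)).
    apply: open_nbhs_nbhs; split; first by rewrite preimage_setC; exact: closed_openC.
    by move=> /(fg n n A (leqnn _) CA).
  by apply: filterS => y /= nA /(fg n n A (leqnn _) CA).
apply: Csep => n A CA; rewrite -(fg' n n A (leqnn _) CA).
have [_ [oB cB]] := pre _ _ CA.
have eB m : (n <= m)%N -> A (f' n (f m x)) <-> A x.
  move=> nm; have [_ _ fK _ _] := fa m.
  by rewrite (fg' n n A)// -(fg' m n A)// fK.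
split.
  move=> AB; have [k _ kP] := cvgf x _ (open_nbhs_nbhs (conj oB AB)).
  by apply/(eB (maxn n k)); [exact: leq_maxl|apply: kP; exact: leq_maxr].
move=> Ax; apply: (@closed_cvg _ _ \oo _ (f ^~ x) _ cB _ (g x) (cvgf x)).
by exists n => // m /= nm; apply/eB.
Qed.


Lemma decides_upto n p : W p -> exists2 U, nbhs p U &
  forall i A, (i <= n)%N -> C i A -> U `<=` A \/ U `<=` ~` A.
Proof.
move=> Wp; elim: n => [|n [U pU Udec]].
  have [U pU Udec] := Wdecides 0 Wp; exists U => // i A.
  by rewrite leqn0 => /eqP ->; exact: Udec.
have [V pV Vdec] := Wdecides n.+1 Wp; exists (U `&` V); first exact: filterI.
move=> i A; rewrite leq_eqVlt => /predU1P[->|ni] CA; last first.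
  by case: (Udec i A ni CA) => // UA; [left|right] => x [/UA].
by case: (Vdec A CA) => // VA; [left|right] => x [_ /VA].
Qed.

Lemma forth_step (E F : set T) n f f' a : auto_pair f f' -> E `<=` W -> dense E ->
    finite_set F -> W a -> exists g g',
  [/\ auto_pair g g', agree n f g, agree n f' g', forall x, F x -> g x = f x
    & F a \/ E (g a)].
Proof.
move=> fA EW Ed Ffin Wa; have [Fa|nFa] := pselect (F a).
  by exists f, f'; split=> //; left.
have [fc f'c fK f'K fW] := fA;
have [U aU Udec] := decides_upto n Wa.
have [V faV Vdec] := decides_upto n (proj2 (fW a) Wa).
(* A swap supported in [O] respects the sets of level at most [n] for the map (by [V]) and for its
   inverse (by [U]), and keeps the values on [F]. *)
pose O := V^° `&` f' @^-1` U^° `&` ~` (f @` F).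
have oO : open O.
  apply: openI; first apply: openI; first exact: open_interior.
    by apply: open_comp; [move=> x _; exact: f'c|exact: open_interior].
  rewrite openC; have /accessible_finite_set_closed := hausdorff_accessible Thausdorff.
  by apply; exact: finite_image.
have Oa : O (f a).
  split; first by split=> //=; rewrite fK.
  by move=> [x Fx /(can_inj fK) xa]; apply: nFa; rewrite -xa.
have [b [Ob Eb]] := Ed O (ex_intro _ _ Oa) oO.
have [g [gc gK gab gid gW]] := swap (proj2 (fW a) Wa) (EW _ Eb) oO Oa Ob.
have gO y : O y -> O (g y).
  by move=> Oy; apply: contrapT => /[dup] nO /gid; rewrite gK => yg; rewrite yg in Oy.
(* Both agreements follow from this claim: [g] preserves [O], and [B] sends [O] into a set [P] that
   [A] does not split. It is applied with [B] the identity and with [B] equal to [f']. *)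
have decide B P i A : (i <= n)%N -> C i A -> (P `<=` A \/ P `<=` ~` A) ->
    (forall y, O y -> P (B y)) -> forall y, A (B y) <-> A (B (g y)).
  move=> ni CA PA OP y; have [Oy|/gid ->//] := pselect (O y).
  have [PBy PBg] := (OP _ Oy, OP _ (gO _ Oy)).
  case: PA => PA; first by split=> _; [exact: (PA _ PBg)|exact: (PA _ PBy)].
  by split=> Ay; [have /= := PA _ PBy|have /= := PA _ PBg].
exists (g \o f), (f' \o g); split=> /=.
- split=> [x|x|x|x|x] /=.
  + by apply: continuous_comp; [exact: fc|exact: gc].
  + by apply: continuous_comp; [exact: gc|exact: f'c].
  + by rewrite gK fK.
  + by rewrite f'K gK.
  + by rewrite gW.
- move=> i A ni CA x /=; apply: (decide id V i A) => //; first exact: Vdec ni CA.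
  by move=> y [[/interior_subset]].
- move=> i A ni CA x /=; apply: (decide f' U i A) => //; first exact: Udec ni CA.
  by move=> y [[_ /interior_subset]].
- by move=> x Fx /=; apply: gid => -[_]; apply; exists x.
- by right; rewrite gab.
Qed.

Lemma back_and_forth (d e : nat -> T) : range d `<=` W -> range e `<=` W ->
  dense (range d) -> dense (range e) ->
  exists2 f : T -> T, homeomorphism f & f @` range d = range e.
Proof.
move=> dW eW dd de.
(* A state is a homeomorphism, its inverse and the finite set of points whose images are settled for
   good. *)
pose good (s : (T -> T) * (T -> T) * set T) :=
  [/\ auto_pair s.1.1 s.1.2, finite_set s.2, s.2 `<=` range d
    & s.1.1 @` s.2 `<=` range e].
pose next n s t := [/\ agree n s.1.1 t.1.1 /\ agree n s.1.2 t.1.2,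
  s.2 `<=` t.2, forall x, s.2 x -> t.1.1 x = s.1.1 x, t.2 (d n)
  & (t.1.1 @` t.2) (e n)] : Prop.
have step n (s : {s | good s}) : exists t : {t | good t}, next n (sval s) (sval t).
  case: s => -[[f f'] F] [/= fA Ffin Fd Fe].
  have [g [g' [gA fg fg' gF gd]]] := forth_step n fA eW de Ffin (dW _ (imageT d n)).
  pose G := F `|` [set d n].
  have gGfin : finite_set (g @` G).
    by apply: finite_image; rewrite finite_setU; split.
  have gGe : g @` G `<=` range e.
    move=> _ [x [Fx|->] <-]; first by rewrite gF//; apply: Fe; exists x.
    by case: gd => [Fd'|//]; rewrite gF//; apply: Fe; exists (d n).
  have [h' [h [hA gh' gh hG he]]] :=
    forth_step n (auto_pairC gA) dW dd gGfin (eW _ (imageT e n)).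
  have [_ _ gK _ _] := gA; have [_ _ h'K hK _] := hA.
  have hg x : G x -> h x = g x.
    by move=> Gx; rewrite -{1}(gK x) -hG ?h'K//; exists x.
  have dhe : range d (h' (e n)).
    case: he => // -[x Gx gx]; rewrite -gx hG ?gK; last by exists x.
    by case: Gx => [/Fd//|->]; exists n.
  have gt : good (h, h', G `|` [set h' (e n)]).
    split=> /=; first exact: auto_pairC.
    - by rewrite !finite_setU; do !split.
    - by move=> x [[/Fd//|->]|->//]; exists n.
    - move=> _ [x [Gx|->] <-]; last by rewrite h'K; exists n.
      by rewrite hg//; apply: gGe; exists x.
  exists (exist _ _ gt); split=> /=.
  - by split; apply: agree_trans; eassumption.
  - by move=> x Fx; left; left.
  - by move=> x Fx; rewrite hg ?gF//; left.
  - by left; right.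
  - by exists (h' (e n)); [right|rewrite h'K].
have good0 : good (id, id, set0).
  split=> //=; last by move=> ? [].
  by split=> // x; exact: cvg_id.
have [nx nxP] : {nx : nat -> {s | good s} -> {s | good s} |
    forall n s, next n (sval s) (sval (nx n s))}.
  pose nx n s := sval (cid (step n s)).
  by exists nx => n s; exact: (svalP (cid (step n s))).
pose st := fix st n := if n is m.+1 then nx m (st m) else exist _ _ good0.
pose f n := (sval (st n)).1.1; pose f' n := (sval (st n)).1.2.
pose F n := (sval (st n)).2.
have fA n : auto_pair (f n) (f' n) by case: (svalP (st n)).
have stP n : next n (sval (st n)) (sval (st n.+1)) by exact: nxP.
have [g fg] : exists g, forall n, agree n (f n) g.
  by apply: agree_limit => n; have [[]] := stP n.
have [g' fg'] : exists g, forall n, agree n (f' n) g.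
  by apply: agree_limit => n; have [[]] := stP n.
have [gc gK] := agree_homeomorphism fA fg fg'.
have [g'c g'K] := agree_homeomorphism (fun n => auto_pairC (fA n)) fg' fg.
have Fm x n m : (n <= m)%N -> F n x -> F m x /\ f m x = f n x.
  elim: m => [|m IH]; first by rewrite leqn0 => /eqP ->.
  rewrite leq_eqVlt => /predU1P[->//|nm] /(IH nm)[Fx <-].
  by have [_ FS fS _ _] := stP m; split; [exact: FS|exact: fS].
have gF n x : F n x -> g x = f n x.
  move=> Fx; apply: Csep => i A CA.
  have [_ <-] := Fm x n (maxn n i) (leq_maxl _ _) Fx.
  by symmetry; apply: (fg (maxn n i) i) => //; exact: leq_maxr.
exists g; first by split=> //; exists g'; split.
apply/seteqP; split=> [_ [_ [n _ <-] <-]|_ [n _ <-]].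
  have [_ _ _ Fd _] := stP n; have [_ _ _ Fe] := svalP (st n.+1).
  by rewrite (gF n.+1)//; apply: Fe; exists (d n).
have [_ _ _ _ [x Fx fx]] := stP n; have [_ _ Fd _] := svalP (st n.+1).
by exists x; [exact: Fd|rewrite (gF n.+1)].
Qed.

End BackAndForth.

(** * The neighbourhoods of A(Y) *)

Lemma cantor_ltE (x y : cantor_space) : (x < y)%O = cantor_ltb x y.
Proof. by []. Qed.

Lemma cantor_ltP (x y : cantor_space) : (x < y)%O <->
  exists n, [/\ forall m, (m < n)%N -> x m = y m, x n = false & y n = true].
Proof.
rewrite cantor_ltE; split=> [/asboolP[n [xy /andP[xn yn]]]|[n [xy xn yn]]].
  by exists n; split=> //; exact: negbTE.
by apply/asboolP; exists n; rewrite xn yn.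
Qed.

Section Arrow.
Variable Y : set cantor_space.
Local Notation X := (arrow_space Y).

Definition coord (p : X) : cantor_space := (val (p : arrow_order Y)).1.
Definition upper (p : X) : bool := (val (p : arrow_order Y)).2.

Lemma arrow_inj p q : coord p = coord q -> upper p = upper q -> p = q.
Proof.
move=> pq1 pq2; apply: (@val_inj _ _ (arrow_order Y)).
by rewrite [LHS]surjective_pairing [RHS]surjective_pairing; congr pair.
Qed.

Lemma arrow_point x b : (if b then Qtail false x \/ Y x else ~ Qtail false x) ->
  exists p : X, coord p = x /\ upper p = b.
Proof.
move=> xb; have xbA : arrow_set Y (x, b) by case: b xb; [right|left].
by exists (exist _ (x, b) (mem_set xbA)).
Qed.

Lemma arrow_pointP p :
  if upper p then Qtail false (coord p) \/ Y (coord p)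
  else ~ Qtail false (coord p).
Proof.
have /set_mem[[]|[]] := valP (p : arrow_order Y);
  by rewrite /coord /upper /= => ? ->.
Qed.

Lemma arrow_ltP p q : (p < q)%O <->
  (coord p < coord q)%O \/ [/\ coord p = coord q, ~~ upper p & upper q].
Proof.
have -> : (p < q)%O = (val (p : arrow_order Y) < val (q : arrow_order Y))%O by [].
rewrite Order.ProdLexiOrder.ltEprodlexi -/(coord p) -/(coord q) -/(upper p) -/(upper q).
have [pq|pq|<-] := ltgtP (coord p) (coord q).
- by split=> // _; left.
- by split=> // -[//|[/eqP]]; rewrite gt_eqF.
- rewrite implyTb; case: (upper p) (upper q) => -[]; split=> //; first [by right|by case=> // -[]].
Qed.

Definition cone (x : cantor_space) (n : nat) : set X :=
  [set q | forall i, (i < n)%N -> coord q i = x i].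

Definition cut (y : cantor_space) : set X :=
  [set q | (coord q < y)%O \/ (coord q = y /\ ~~ upper q)].

(* Over Y, the left (lower) point sees only the branches on its left, i.e. those
   leaving its coordinate at a digit 1, and the right point those on its right. *)
Definition directed (p : X) (k : nat) : Prop :=
  Y (coord p) -> coord p k = ~~ upper p.

Definition branch (p : X) (k : nat) : set X :=
  [set q | (forall i, (i < k)%N -> coord q i = coord p i)
           /\ coord q k = ~~ coord p k].

(** A neighbourhood base at [p]. Off [Y] every branch is directed and this is a whole cone; over [Y]
    it is the half of the cone on the side of [p]. *)
Definition vicinity (p : X) (n : nat) : set X :=
  [set q | q = p \/ exists k, [/\ (n <= k)%N, directed p k & branch p k q]].

Hypothesis YQ : Y `<=` ~` Qset.

Lemma Y_Qtail y i : Y y -> ~ Qtail i y.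
Proof. by case: i => /YQ yQ ?; apply: yQ; [right|left]. Qed.

Lemma two_points_Y p q : coord p = coord q -> ~~ upper p -> upper q -> Y (coord p).
Proof.
move=> pq pF qT; have := arrow_pointP p; have := arrow_pointP q.
by rewrite (negbTE pF) qT -pq => -[].
Qed.

Lemma same_coord p q : ~ Y (coord p) -> coord p = coord q -> p = q.
Proof.
move=> nY pq; apply: arrow_inj => //.
have := @two_points_Y p q pq; have := @two_points_Y q p (esym pq).
by rewrite -pq; case: (upper p) (upper q) => -[] // A B; case: nY; [exact: A|exact: B].
Qed.

(** The two points over [y] are adjacent, so [cut y] is the open ray below the upper one and its
    complement the open ray above the lower one. *)
Lemma cut_openP y : Y y -> open (cut y) /\ open (~` cut y).
Proof.
move=> Yy; have [a [ay aF]] := @arrow_point y false (Y_Qtail Yy).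
have [b [by_ bT]] := @arrow_point y true (or_intror Yy).
have -> : cut y = `]-oo, b[%classic.
  apply/seteqP; split=> q; rewrite /= in_itv/=.
    move=> qy; apply/arrow_ltP; rewrite by_ bT.
    by case: qy => [|[]]; [left|right].
  by move=> /arrow_ltP; rewrite by_ => -[|[]]; [left|right].
split; first exact: lray_open.
have -> : ~` `]-oo, b[ = `]a, +oo[%classic; last exact: rray_open.
apply/seteqP; split=> q; rewrite /= !in_itv/= andbT.
  move=> /negP; rewrite -leNgt le_eqVlt => /predU1P[<-|].
    by apply/arrow_ltP; right; rewrite ay by_ aF bT.
  move=> /arrow_ltP[|[_]]; last by rewrite bT.
  by rewrite by_ => yq; apply/arrow_ltP; left; rewrite ay.
move=> /arrow_ltP + /arrow_ltP; rewrite ay by_ aF bT => -[yq|[<- _ qT]] [qy|[qy qF]].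
- by have := lt_trans yq qy; rewrite ltxx.
- by move: yq; rewrite qy ltxx.
- by move: qy; rewrite ltxx.
- by rewrite qT in qF.
Qed.

Lemma cut_clopen y : Y y -> clopen (cut y).
Proof. by move=> /cut_openP[o c]; split=> //; rewrite -openC. Qed.

Lemma cone_open x n : open (cone x n).
Proof.
elim: n => [|n IH].
  have -> : cone x 0 = setT by apply/seteqP.
  exact: openT.
have -> : cone x n.+1 = cone x n `&` [set q | coord q n = x n].
  apply/seteqP; split=> q /=; first by move=> qx; split=> [i ni|]; apply: qx => //; exact: ltnW.
  by move=> [qx qn] i; rewrite ltnS leq_eqVlt => /predU1P[->|/qx].
(* [z false] is the largest sequence of the left half of the cone and [z true] the smallest of the
   right half. Only a lower point lies over the first and only an upper point over the second, so
   each half is the cone intersected with an open ray. *)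
pose z i : cantor_space := fun j => if (j < n)%N then x j else if j == n then i else ~~ i.
have zQ i : Qtail (~~ i) (z i).
  by exists n.+1 => m nm; rewrite /z ltnNge ltnW//= gtn_eqF.
case xn : (x n).
  have [l [lz lF]] : exists p : X, coord p = z false /\ upper p = false.
    apply: arrow_point => -[m mP]; have [k kP] := zQ false.
    by have := mP (maxn m k) (leq_maxl _ _); rewrite kP// leq_maxr.
  have -> : cone x n `&` [set q | coord q n = true] = cone x n `&` `]l, +oo[.
    apply/seteqP; split=> q [qx qn]; split=> //; move: qn; rewrite /= in_itv/= andbT.
      move=> qn; apply/arrow_ltP; left; rewrite lz; apply/cantor_ltP; exists n.
      by rewrite /z ltnn eqxx; split=> // m mn; rewrite mn qx.
    move=> /arrow_ltP[]; rewrite lz.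
      move=> /cantor_ltP[m [zq zm qm]]; move: zm; rewrite /z.
      have [mn|//|<-//] := ltngtP m n.
      by rewrite -(qx _ mn) qm.
    move=> [zq _ qT]; have := arrow_pointP q; rewrite qT -zq => -[[m mP]|].
      have [k kP] := zQ false.
      by have := mP (maxn m k) (leq_maxl _ _); rewrite kP// leq_maxr.
    by move=> /(@Y_Qtail _ true)[]; exact: zQ.
  by apply: openI => //; exact: rray_open.
have [r [rz rT]] : exists p : X, coord p = z true /\ upper p = true.
  by apply: arrow_point; left; exact: zQ.
have -> : cone x n `&` [set q | coord q n = false] = cone x n `&` `]-oo, r[.
  apply/seteqP; split=> q [qx qn]; split=> //; move: qn; rewrite /= in_itv/=.
    move=> qn; apply/arrow_ltP; left; rewrite rz; apply/cantor_ltP; exists n.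
    by rewrite /z ltnn eqxx; split=> // m mn; rewrite mn qx.
  move=> /arrow_ltP[]; rewrite rz.
    move=> /cantor_ltP[m [zq qm zm]]; move: zm; rewrite /z.
    have [mn|//|<-//] := ltngtP m n.
    by rewrite -(qx _ mn) qm.
  move=> [zq qF _]; have := arrow_pointP q; rewrite (negbTE qF) zq => -[].
  exact: zQ.
by apply: openI => //; exact: lray_open.
Qed.

Lemma coneC_open x n : open (~` cone x n).
Proof.
rewrite openE => q /existsNP[i /not_implyP[ni qi]].
have : nbhs q (cone (coord q) i.+1).
  by apply: open_nbhs_nbhs; split=> //; exact: cone_open.
rewrite /interior /=; apply: filterS.
by move=> r rq /(_ i ni); rewrite rq.
Qed.

Lemma cone_clopen x n : clopen (cone x n).
Proof. by split; [exact: cone_open|rewrite -openC; exact: coneC_open]. Qed.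

Lemma nbhs_cone p n : nbhs p (cone (coord p) n).
Proof. by apply: open_nbhs_nbhs; split=> //; exact: cone_open. Qed.

Lemma vicinity_self p n : vicinity p n p. Proof. by left. Qed.

Lemma vicinityS p m n : (m <= n)%N -> vicinity p n `<=` vicinity p m.
Proof.
by move=> mn q [->|[k [nk]]]; [left|right; exists k; split=> //; exact: leq_trans nk].
Qed.

Lemma vicinity_cone p n : vicinity p n `<=` cone (coord p) n.
Proof. by move=> q [->//|[k [nk _ [qp _]]]] i ni; apply: qp; exact: leq_trans nk. Qed.

Lemma cut_upper p q : coord q = coord p -> cut (coord p) q <-> ~~ upper q.
Proof. by move=> <-; split=> [[|[]//]|qF]; [rewrite ltxx|right]. Qed.

(** If [q] has another coordinate, it leaves that of [p] at some digit [k >= n], and over [Y] the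
    cut condition puts it on the side that [directed] demands. If the coordinates coincide, the cut
    condition forces [q = p]. *)
Lemma cone_cut_vicinity p n q : cone (coord p) n q ->
  (Y (coord p) -> cut (coord p) q <-> cut (coord p) p) -> vicinity p n q.
Proof.
move=> qp qB; have cutp := @cut_upper p p erefl.
have kn k x y : coord q k = x -> coord p k = y -> x <> y -> (n <= k)%N.
  move=> qk pk xy; rewrite leqNgt; apply/negP => kn.
  by apply: xy; rewrite -qk -pk; exact: qp.
have [lt|lt|pq] := ltgtP (coord q) (coord p).
- have [k [qk qkF pkT]] := proj1 (cantor_ltP _ _) lt.
  right; exists k; split; [exact: (kn k false true)| |by split=> //; rewrite qkF pkT].
  by move=> Yp; rewrite pkT; apply/esym/cutp/(qB Yp); left.
- have [k [pk pkF qkT]] := proj1 (cantor_ltP _ _) lt.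
  right; exists k; split; [| |by split=> [m /pk//|]; rewrite qkT pkF].
    exact: (kn k true false).
  move=> Yp; rewrite pkF; apply/esym/negbTE/negP => pF.
  have [|[qp' _]] := proj2 (qB Yp) (proj2 cutp pF).
    by move=> /(lt_trans lt); rewrite ltxx.
  by move: lt; rewrite qp' ltxx.
- left; have [Yp|nY] := pselect (Y (coord p)); last by apply/esym/same_coord.
  apply: arrow_inj => //; have := qB Yp; rewrite (cut_upper pq) cutp.
  by case: (upper q) (upper p) => -[] // [A B']; [have := B' isT|have := A isT].
Qed.

Lemma nbhs_vicinity p n : nbhs p (vicinity p n).
Proof.
pose B := [set q : X | Y (coord p) -> cut (coord p) q <-> cut (coord p) p].
have pB : nbhs p B.
  have [Yp|nY] := pselect (Y (coord p)); last first.
    by have -> : B = setT by [apply/seteqP]; exact: filterT.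
  have [oc oC] := cut_openP Yp; have [pc|npc] := pselect (cut (coord p) p).
    by apply: filterS (open_nbhs_nbhs (conj oc pc)) => q.
  by apply: filterS (open_nbhs_nbhs (conj oC npc)) => q.
by apply: filterS (filterI pB (nbhs_cone p n)) => q [qB qp]; exact: cone_cut_vicinity.
Qed.

Lemma vicinity_gt (a p : X) : (a < p)%O ->
  exists n, forall q, vicinity p n q -> (a < q)%O.
Proof.
move=> ap; move: (ap) => /arrow_ltP[/cantor_ltP[m [apm am pm]]|[ap1 aF pT]].
  exists m.+1 => q /vicinity_cone qp; apply/arrow_ltP; left; apply/cantor_ltP.
  by exists m; split=> // [i im|]; rewrite qp// ?apm// ltnS ltnW.
(* Here [a] and [p] are the two points over one element of [Y]. Every directed branch of the upper
   point lies to its right, so level 0 suffices. *)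
exists 0 => q [->//|[k [_ dk [qk qkN]]]].
have pk : coord p k = false by rewrite dk ?pT// -ap1; exact: two_points_Y ap1 aF pT.
apply/arrow_ltP; left; rewrite ap1; apply/cantor_ltP; exists k.
by split=> // [m /qk|]; rewrite ?qkN ?pk.
Qed.

Lemma vicinity_lt (p b : X) : (p < b)%O ->
  exists n, forall q, vicinity p n q -> (q < b)%O.
Proof.
move=> pb; move: (pb) => /arrow_ltP[/cantor_ltP[m [pbm pm bm]]|[pb1 pF bT]].
  exists m.+1 => q /vicinity_cone qp; apply/arrow_ltP; left; apply/cantor_ltP.
  by exists m; split=> // [i im|]; rewrite qp// ?pbm// ltnS ltnW.
exists 0 => q [->//|[k [_ dk [qk qkN]]]].
have pk : coord p k = true by rewrite dk ?pF//; exact: two_points_Y pb1 pF bT.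
apply/arrow_ltP; left; rewrite -pb1; apply/cantor_ltP; exists k.
by split=> //; rewrite qkN pk.
Qed.

Lemma nbhs_vicinityP p (U : set X) : nbhs p U <-> exists n, vicinity p n `<=` U.
Proof.
split=> [|[n nU]]; last exact: filterS nU (nbhs_vicinity p n).
rewrite itv_nbhsE => -[[l r] [iop pi] iU].
have [m mP] : exists m, forall q, vicinity p m q -> (l <= BLeft q)%O.
  case: l iop pi {iU} => [[] a|[]] //.
  - move=> _ /andP[]; rewrite /= !bnd_simp => /vicinity_gt[n nP] _; exists n => q /nP.
    by rewrite bnd_simp.
  - by exists 0.
have [n nP] : exists n, forall q, vicinity p n q -> (BRight q <= r)%O.
  case: r iop pi {iU} => [[] b|[]] //.
  - move=> _ /andP[] _; rewrite /= !bnd_simp => /vicinity_lt[k kP]; exists k => q /kP.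
    by rewrite bnd_simp.
  - by case: l {mP} => [[]?|[]].
  - by case: l {mP} => [[]?|[]].
  - by exists 0.
exists (maxn m n) => q qmn; apply: iU; rewrite /= itv_boundlr.
by rewrite mP ?nP//; apply: vicinityS qmn; rewrite ?leq_maxl ?leq_maxr.
Qed.

End Arrow.

(** * Open rays as a subbase, and compactness *)

Lemma order_topological_linearly_ordered d (T : orderTopologicalType d) :
  linearly_ordered_space T.
Proof.
exists (<=%O : rel T).
  by do !split; [exact: lexx|exact: le_trans|exact: le_anti|exact: le_total].
pose f (p : bool * T) := if p.1 then [set x | ~~ (x <= p.2)%O]
                        else [set x | ~~ (p.2 <= x)%O].
have fo p : open (f p).
  case: p => -[] a; rewrite /f /=.
    have -> : [set x | ~~ (x <= a)%O] = `]a, +oo[%classic; last exact: rray_open.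
    by apply/seteqP; split=> x; rewrite /= in_itv/= andbT -ltNge.
  have -> : [set x | ~~ (a <= x)%O] = `]-oo, a[%classic; last exact: lray_open.
  by apply/seteqP; split=> x; rewrite /= in_itv/= -ltNge.
split=> [_ [D _ <-]|x U].
  rewrite bigcap_fset; apply: (big_ind open); [exact: openT|exact: openI|].
  by move=> p _; exact: fo.
rewrite itv_nbhsE => -[[l r] [iop xi] iU].
(* The empty intersection serves for an infinite endpoint. *)
have finT : finI_from [set: bool * T] f setT.
  by exists fset0; rewrite ?set_fset0 ?bigcap_set0.
have [A [fA Ax lA]] : exists A, [/\ finI_from [set: bool * T] f A, A x &
    forall q, A q -> (l <= BLeft q)%O].
  case: l iop xi {iU} => [[] a|[]] //.
  - move=> _ /andP[]; rewrite /= !bnd_simp => ax _; exists (f (true, a)).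
    split; [exact: finI_from1|by rewrite /f /= -ltNge|].
    by move=> q; rewrite /f /= -ltNge bnd_simp.
  - by exists setT.
have [B [fB Bx rB]] : exists B, [/\ finI_from [set: bool * T] f B, B x &
    forall q, B q -> (BRight q <= r)%O].
  case: r iop xi {iU} => [[] b|[]] //.
  - move=> _ /andP[] _; rewrite /= !bnd_simp => xb; exists (f (false, b)).
    split; [exact: finI_from1|by rewrite /f /= -ltNge|].
    by move=> q; rewrite /f /= -ltNge bnd_simp.
  - by case: l {lA} => [[]?|[]].
  - by case: l {lA} => [[]?|[]].
  - by exists setT.
exists (A `&` B); first by split; [exact: finI_fromI|].
by move=> q [Aq Bq]; apply: iU; rewrite /= itv_boundlr lA// rB.
Qed.

Lemma cantor_nbhs_prefix (x : cantor_space) n :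
  nbhs x [set y : cantor_space | forall i, (i < n)%N -> y i = x i].
Proof.
elim: n => [|n IH]; first by apply: filterS filterT.
have xn : nbhs x (proj n @^-1` [set x n] : set cantor_space).
  by apply: (@proj_continuous _ (fun _ : nat => bool) n x); exact: discrete_set1.
apply: filterS (filterI IH xn) => y [yx yn] i.
by rewrite ltnS leq_eqVlt => /predU1P[->|/yx].
Qed.

(** Otherwise there are points outside [U] sharing ever longer prefixes with [x]. By compactness
    they cluster, necessarily at [x], which contradicts that [U] is a neighbourhood. *)
Lemma cantor_nbhsP (x : cantor_space) U : nbhs x U ->
  exists n, forall y : cantor_space, (forall i, (i < n)%N -> y i = x i) -> U y.
Proof.
move=> xU; apply: contrapT => /forallNP nU.
have /choice[y yP] : forall n, exists y : cantor_space,
    (forall i, (i < n)%N -> y i = x i) /\ ~ U y.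
  by move=> n; have /existsNP[y /not_implyP] := nU n; exists y.
have [z [_ clz]] := cantor_space_compact (fmap_proper_filter y eventually_filter)
  filterT.
have zx : z = x.
  apply/funext => i; have [w [wx wz]] : [set y : cantor_space | y i = x i]
      `&` [set y : cantor_space | forall j, (j < i.+1)%N -> y j = z j] !=set0.
    apply: clz; last exact: cantor_nbhs_prefix.
    by exists i.+1 => // n /= ni; have [+ _] := yP n; apply.
  by rewrite -wz.
rewrite {}zx in clz.
have [w [nw Uw]] : (~` U) `&` U !=set0 by apply: clz => //; exists 0 => // n _; have [] := yP n.
by [].
Qed.

(** The coordinates of an ultrafilter cluster at some [x], and the ultrafilter then contains all
    cones around [x]. When [x] is in [Y], it also contains [cut x] or its complement, which selects
    the limit among the two points over [x]. *)
Lemma arrow_compact Y : Y `<=` ~` Qset -> compact [set: arrow_space Y].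
Proof.
move=> YQ; rewrite compact_ultra => F FU _.
have FP : ProperFilter F by exact: ultra_proper.
have [x [_ clx]] := cantor_space_compact (fmap_proper_filter (@coord Y) FP) filterT.
have Fcone n : F (cone x n).
  have [//|FC] := in_ultra_setVsetC (cone x n) FU.
  have [y [yx]] : [set y : cantor_space | ~ forall i, (i < n)%N -> y i = x i] `&`
      [set y | forall i, (i < n)%N -> y i = x i] !=set0.
    by apply: clx => //; exact: cantor_nbhs_prefix.
  by [].
have conv p : coord p = x -> (Y x -> F [set q | cut x q <-> cut x p]) -> F --> p.
  move=> px Fp U /(nbhs_vicinityP YQ)[n nU]; apply: filterS nU _.
  have [Yx|nY] := pselect (Y x).
    apply: filterS (filterI (Fcone n) (Fp Yx)) => q [qn qp].
    by apply: cone_cut_vicinity; rewrite px.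
  by apply: filterS (Fcone n) => q qn; apply: cone_cut_vicinity; rewrite px.
have [Yx|nY] := pselect (Y x).
  have [p [px pF]] := @arrow_point Y x false (@Y_Qtail _ YQ x false Yx).
  have [q [qx qT]] := @arrow_point Y x true (or_intror Yx).
  have [Fc|Fc] := in_ultra_setVsetC (cut x) FU.
    exists p; split=> //; apply: conv => // _; apply: filterS Fc => r rx.
    by split=> // _; right; rewrite px pF.
  exists q; split=> //; apply: conv => // _; apply: filterS Fc => r rx.
  by split=> // -[|[]]; rewrite qx ?ltxx ?qT.
have [xQ|xQ] := pselect (Qtail false x).
  have [p [px _]] := @arrow_point Y x true (or_introl xQ).
  by exists p; split=> //; apply: conv.
have [p [px _]] := @arrow_point Y x false xQ.
by exists p; split=> //; apply: conv.
Qed.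

Lemma unbounded_nat_enum (I : set nat) : (forall n, exists2 m, (n <= m)%N & I m) ->
  exists2 e : nat -> nat, injective e & range e = I.
Proof.
move=> Iunb; have Iinf : infinite_set I.
  move=> /finite_seqP[s Is]; have [m] := Iunb (\max_(i <- s) i).+1.
  rewrite Is /= => + ms; apply/negP; rewrite -leqNgt.
  exact: (@leq_bigmax_seq _ s xpredT id).
have /card_set_bijP[e [eI einj esurj]] : [set: nat] #= I.
  by rewrite card_eq_le; apply/andP; split; [exact/infiniteP|exact: countableP].
exists e; first by move=> i j; apply: einj; exact: in_setT.
by apply/seteqP; split=> [_ [i _ <-]|m /esurj[i _ <-]]; [exact: eI|exists i].
Qed.

(** An enumeration obtained from cardinality need not increase. Injectivity still makes it leave
    every initial segment, which is what convergence of the enumerated branches requires. *)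
Lemma injective_nat_unbounded (e : nat -> nat) : injective e ->
  forall n, exists k, forall i, (k <= i)%N -> (n <= e i)%N.
Proof.
move=> einj; elim=> [|n [k kP]]; first by exists 0.
have [[j ej]|nj] := pselect (exists j, e j = n); last first.
  by exists k => i ki; rewrite ltn_neqAle kP// andbT; apply/eqP => en; apply: nj; exists i.
exists (maxn k j.+1) => i; rewrite geq_max => /andP[ki ji].
by rewrite ltn_neqAle kP// andbT -ej; apply/eqP => /einj ij; rewrite ij ltnn in ji.
Qed.

(** * Exchanging two points *)

Section SwapSequences.
Variables (T : topologicalType) (p : bool -> T) (S : nat -> bool -> set T).
Variable h : nat -> bool -> T -> T.
Hypotheses (Thausdorff : hausdorff_space T).
Hypothesis Sclopen : forall i b, clopen (S i b).
Hypothesis Sdisj : forall i b j c x, S i b x -> S j c x -> i = j /\ b = c.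
Hypothesis Sp : forall i b c, ~ S i b (p c).
Hypothesis Sh : forall i b x, S i b x -> S i (~~ b) (h i b x).
Hypothesis hK : forall i b x, S i b x -> h i (~~ b) (h i b x) = x.
Hypothesis hc : forall i b x, S i b x -> h i b y @[y --> x] --> h i b x.
Hypothesis Scvg : forall b U, nbhs (p b) U ->
  exists k, forall i, (k <= i)%N -> S i b `<=` U.
Hypothesis Snbhs : forall b k,
  nbhs (p b) [set x | x = p b \/ exists2 i, (k <= i)%N & S i b x].

(** The map exchanges the two points, exchanges [S i true] with [S i false] through [h], and is the
    identity elsewhere. Continuity at the two points comes from [Scvg] and [Snbhs], on the sets
    [S i b] from [hc]. *)
Lemma swap_sequences : exists g : T -> T,
  [/\ continuous g, cancel g g, forall b, g (p b) = p (~~ b),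
      forall i b x, S i b x -> g x = h i b x
    & forall x, (forall b, x <> p b) -> (forall i b, ~ S i b x) -> g x = x].
Proof.
have /choice[g gP] : forall x, exists y, [/\ forall b, x = p b -> y = p (~~ b),
    forall i b, S i b x -> y = h i b x
  & (forall b, x <> p b) -> (forall i b, ~ S i b x) -> y = x].
  move=> x; have [[b xb]|np] := pselect (exists b, x = p b).
    exists (p (~~ b)); split=> [c|i c|/(_ b)//]; rewrite xb; last by move/Sp.
    by case: b c {xb} => -[].
  have [[[i b] /= Sx]|nS] := pselect (exists ib, S ib.1 ib.2 x).
    exists (h i b x); split=> [c xc|j c Sx'|_ /(_ i b)//].
      by case: np; exists c.
    by have [-> ->] := Sdisj Sx Sx'.
  exists x; split=> [c xc|j c Sx|//]; first by case: np; exists c.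
  by case: nS; exists (j, c).
have gp b : g (p b) = p (~~ b) by have [+ _ _] := gP (p b); apply.
have gS i b x : S i b x -> g x = h i b x by have [_ + _] := gP x; apply.
have gid x : (forall b, x <> p b) -> (forall i b, ~ S i b x) -> g x = x.
  by have [_ _] := gP x.
exists g; split=> // x; last first.
  have [[b ->]|np] := pselect (exists b, x = p b); first by rewrite !gp negbK.
  have [[[i b] /= Sx]|nS] := pselect (exists ib, S ib.1 ib.2 x).
    by rewrite (gS i b x)// (gS _ _ _ (Sh Sx)) hK.
  have gx : g x = x.
    by apply: gid => [b xb|i b Sx]; [case: np; exists b|case: nS; exists (i, b)].
  by rewrite gx.
have [[b ->]|np] := pselect (exists b, x = p b).
  rewrite /continuous_at gp => U pU; have [k kU] := Scvg pU.
  apply: filterS (Snbhs b k) => y /= [->|[i ki Sy]].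
    by rewrite gp; exact: nbhs_singleton.
  by rewrite (gS i b)//; apply: (kU i ki); exact: Sh.
have [[[i b] /= Sx]|nS] := pselect (exists ib, S ib.1 ib.2 x).
  rewrite /continuous_at (gS i b)// => U /(hc Sx) hU.
  have {}hU : nbhs x (h i b @^-1` U) by [].
  have xS : nbhs x (S i b) by apply: open_nbhs_nbhs; split=> //; case: (Sclopen i b).
  by apply: filterS (filterI hU xS) => y [Uy Sy]; rewrite /= (gS i b).
(* Some neighbourhood of [x] is disjoint from a neighbourhood of [p b] that contains all but
   finitely many [S i b]; the remaining ones are closed and miss [x]. *)
have far b : nbhs x [set y | y <> p b /\ forall i, ~ S i b y].
  have /eqP xb : x <> p b by move=> xb; apply: np; exists b.
  have := Thausdorff; rewrite open_hausdorff => /(_ _ _ xb)[[A B] /= [xA pB] [oA oB AB]].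
  have [|k kB] := Scvg (b := b) (U := B).
    by apply: open_nbhs_nbhs; split=> //; exact: set_mem.
  have xk : nbhs x [set y | forall i, (i < k)%N -> ~ S i b y].
    elim: k {kB} => [|k IH]; first by apply: filterS filterT.
    have : nbhs x (~` S k b).
      apply: open_nbhs_nbhs; split; first by case: (Sclopen k b) => _ /closed_openC.
      by move=> Sx; apply: nS; exists (k, b).
    move=> xS; apply: filterS (filterI IH xS) => y [yk ySk] i.
    by rewrite ltnS leq_eqVlt => /predU1P[->|/yk].
  have xA' : nbhs x A by apply: open_nbhs_nbhs; split=> //; exact: set_mem.
  have disj y : A y -> B y -> False.
    by move=> Ay By; have /seteqP[/(_ y (conj Ay By))] := eqP AB.
  apply: filterS (filterI xk xA') => y [yk Ay]; split.
    by move=> yp; apply: (disj y) => //; rewrite yp; exact: set_mem.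
  move=> i Sy; have [ki|/yk//] := leqP k i.
  exact: disj Ay (kB i ki y Sy).
rewrite /continuous_at gid; last 2 first.
- by move=> b xb; apply: np; exists b.
- by move=> i b Sx; apply: nS; exists (i, b).
move=> U xU; apply: filterS (filterI xU (filterI (far true) (far false))).
by move=> y [Uy [[yt St] [yf Sf]]] /=; rewrite gid// => [[]//|i []].
Qed.

End SwapSequences.

(** * Tail equivalence and shifts between cones *)

Lemma tail_equiv_sym x y : tail_equiv x y -> tail_equiv y x.
Proof. by move=> [m [n xy]]; exists n, m => k; rewrite xy. Qed.

Lemma tail_equiv_trans x y z : tail_equiv x y -> tail_equiv y z -> tail_equiv x z.
Proof.
move=> [m [n xy]] [m' [n' yz]]; exists (m + m')%N, (n' + n)%N => k.
by rewrite -addnA xy -addnA -yz; congr y; lia.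
Qed.

Lemma Qtail_tail_equiv i x y : tail_equiv x y -> Qtail i x -> Qtail i y.
Proof.
move=> [m [n xy]] [k kP]; exists (n + k)%N => j nkj.
have -> : j = (n + (j - n))%N by lia.
by rewrite -xy kP//; lia.
Qed.

Lemma saturatedP (Y : set cantor_space) x y :
  saturated Y -> tail_equiv x y -> Y x -> Y y.
Proof. by move=> -> xy [z Yz xz]; exists z => //; apply: tail_equiv_trans (tail_equiv_sym xy) xz. Qed.

Definition splice (y : cantor_space) (l k : nat) (x : cantor_space) : cantor_space :=
  fun i => if (i < l)%N then y i else x (i - l + k)%N.

Lemma splice_tail_equiv y l k x : tail_equiv (splice y l k x) x.
Proof.
exists l, k => j; rewrite /splice ltnNge leq_addr /=; congr x; lia.
Qed.

Section Shift.
Variable Y : set cantor_space.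
Hypotheses (YQ : Y `<=` ~` Qset) (Ysat : saturated Y).
Local Notation X := (arrow_space Y).

(** Membership in [Qtail false] and, by saturation, in [Y] is invariant under tail equivalence, so
    the new coordinate carries a point on the same side. *)
Lemma shift_subproof y l k (q : X) :
  exists r : X, coord r = splice y l k (coord q) /\ upper r = upper q.
Proof.
have zq := splice_tail_equiv y l k (coord q); apply: arrow_point.
have := arrow_pointP q; case: (upper q) => [[qQ|Yq]|nQ].
- by left; apply: Qtail_tail_equiv qQ; exact: tail_equiv_sym.
- by right; apply: saturatedP Yq => //; exact: tail_equiv_sym.
- by move=> /(Qtail_tail_equiv zq).
Qed.

Definition shift y l k q : X := sval (cid (shift_subproof y l k q)).

Lemma coord_shift y l k q : coord (shift y l k q) = splice y l k (coord q).
Proof. by rewrite /shift; case: cid => r []. Qed.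

Lemma upper_shift y l k q : upper (shift y l k q) = upper q.
Proof. by rewrite /shift; case: cid => r []. Qed.

Lemma shift_cone y l k q : cone y l (shift y l k q).
Proof. by move=> i il; rewrite coord_shift /splice il. Qed.

Lemma shiftK x y l k q : cone x k q -> shift x k l (shift y l k q) = q.
Proof.
move=> qx; apply: arrow_inj; last by rewrite !upper_shift.
apply/funext => i; rewrite !coord_shift /splice.
case: ltnP => [ik|ki]; first by rewrite qx.
by rewrite ltnNge leq_addl /=; congr (coord q); lia.
Qed.

Lemma shift_continuous y l k : continuous (shift y l k).
Proof.
move=> q U /(nbhs_vicinityP YQ)[n nU]; apply/(nbhs_vicinityP YQ).
(* A branch at digit [m] goes to a branch at digit [m - k + l]. Starting from [n + k] ensures that
   [m] survives the removal of [k] digits and that the new digit is at least [n]. *)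
exists (n + k)%N => r [->|[m [nkm dm [rm rmN]]]]; apply: nU.
  exact: vicinity_self.
right; exists (m - k + l)%N; split; first lia.
  rewrite /directed coord_shift upper_shift => Yz.
  rewrite /splice ltnNge leq_addl /=.
  have -> : (m - k + l - l + k = m)%N by lia.
  by apply: dm; apply: saturatedP Yz => //; exact: splice_tail_equiv.
split=> [i im|].
  rewrite !coord_shift /splice; case: ltnP => // li.
  by rewrite rm//; lia.
rewrite !coord_shift /splice ltnNge leq_addl /=.
by have -> : (m - k + l - l + k = m)%N by lia.
Qed.

Definition flip (x : cantor_space) (k : nat) : cantor_space :=
  fun i => if i == k then ~~ x i else x i.

Lemma branch_cone (p : X) k : branch p k = cone (flip (coord p) k) k.+1.
Proof.
apply/seteqP; split=> [q [qp qk] i|q qp].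
  by rewrite ltnS leq_eqVlt /flip => /predU1P[->|ik]; rewrite ?eqxx// ltn_eqF// qp.
split=> [i ik|]; first by rewrite qp ?ltnS ?(ltnW ik)// /flip ltn_eqF.
by rewrite qp// /flip eqxx.
Qed.

Lemma branch_disjoint (p q : X) i j : branch p i q -> branch p j q -> i = j.
Proof.
move=> [qi qiN] [qj qjN]; have [/qj|/qi|//] := ltngtP i j.
  by rewrite qiN; case: (coord p i).
by rewrite qjN; case: (coord p j).
Qed.

(** A sequence in [Y] is not eventually constant, so each digit occurs arbitrarily late. *)
Lemma directed_unbounded (p : X) n : exists2 m, (n <= m)%N & directed p m.
Proof.
have [Yp|nY] := pselect (Y (coord p)); last by exists n.
apply: contrapT => nm; apply: (@Y_Qtail _ YQ _ (upper p) Yp).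
exists n => m nm'; apply: contrapT => pm; apply: nm; exists m => // _.
by move: pm; case: (coord p m) (upper p) => -[].
Qed.

(** Inside disjoint neighbourhoods of [p] and [q] contained in [V], the directed branches of the two
    points are enumerated, and the [i]-th branches are exchanged by shifts. Shifts preserve tail
    classes, hence [Z]. *)
Lemma arrow_swap (Z : set cantor_space) (p q : X) (V : set X) :
    (forall x y, tail_equiv x y -> Z x -> Z y) ->
    Z (coord p) -> Z (coord q) -> open V -> V p -> V q ->
  exists g : X -> X, [/\ continuous g, cancel g g, g p = q,
    forall x, ~ V x -> g x = x & forall x, Z (coord (g x)) <-> Z (coord x)].
Proof.
move=> Zsat Zp Zq oV Vp Vq.
have [<-|/eqP pq] := pselect (p = q).
  by exists id; split=> // x; exact: cvg_id.
have Xh := @order_hausdorff _ X.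
have := Xh; rewrite open_hausdorff => /(_ _ _ pq)[[A B] /= [/set_mem pA /set_mem qB] [oA oB AB]].
pose P b := if b then q else p; pose O b := V `&` if b then B else A.
have PO b : nbhs (P b) (O b).
  by apply: open_nbhs_nbhs; case: b; split=> //=; exact: openI.
have Odisj b x : O b x -> O (~~ b) x -> False.
  have AB0 : A x -> B x -> False.
    by move=> Ax Bx; have /seteqP[/(_ x (conj Ax Bx))] := eqP AB.
  by case: b => -[_ Ox] [_ Ox']; apply: AB0.
have /choice[N NO] : forall b, exists n, vicinity (P b) n `<=` O b.
  by move=> b; apply/(nbhs_vicinityP YQ).
pose I b : set nat := [set k | (N b <= k)%N /\ directed (P b) k].
have /choice[e eP] : forall b, exists e : nat -> nat, injective e /\ range e = I b.
  move=> b; have [n|e ei er] := @unbounded_nat_enum (I b); last by exists e.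
  have [m] := directed_unbounded (P b) (maxn n (N b)); rewrite geq_max => /andP[nm Nm] dm.
  by exists m.
have eI b i : I b (e b i) by have [_ <-] := eP b; exists i.
pose S i b := branch (P b) (e b i).
have SO i b : S i b `<=` O b.
  move=> x Sx; apply: NO; right; exists (e b i).
  by have [? ?] := eI b i.
(* By [branch_cone] a branch at digit [k] is a cone of length [k.+1], whence the successors. *)
pose h i b := shift (flip (coord (P (~~ b))) (e (~~ b) i)) (e (~~ b) i).+1 (e b i).+1.
have Pdisj b i c : ~ S i b (P c).
  move=> SP; have Oc := nbhs_singleton (PO c); have Ob := SO _ _ _ SP.
  have [bc|] := eqVneq c b; last first.
    by case: c b Oc Ob {SP} => -[] // Oc Ob _; [exact: Odisj Ob Oc|exact: Odisj Oc Ob].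
  by move: SP => [_]; rewrite bc; case: (coord _ _).
have [] := @swap_sequences X P S h.
- exact: Xh.
- by move=> i b; rewrite /S branch_cone; exact: cone_clopen.
- move=> i b j c x Si Sj; have [bc|] := eqVneq b c.
    rewrite -bc in Sj *; split=> //; have [+ _] := eP b; apply.
    exact: branch_disjoint Si Sj.
  move: (SO _ _ _ Si) (SO _ _ _ Sj).
  by case: b c {Si Sj} => -[] // Ob Oc _; [case: (Odisj _ _ Ob Oc)|case: (Odisj _ _ Ob Oc)].
- by move=> i b c; exact: Pdisj.
- by move=> i b x _; rewrite /S branch_cone; exact: shift_cone.
- by move=> i b x; rewrite /S branch_cone /h negbK => /shiftK.
- by move=> i b x _; exact: shift_continuous.
- move=> b U /(nbhs_vicinityP YQ)[n nU].
  have [k kP] := injective_nat_unbounded (proj1 (eP b)) n; exists k => i ki x Sx.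
  apply: nU; right; exists (e b i); have [_ ?] := eI b i.
  by split=> //; exact: kP.
- move=> b k; apply/(nbhs_vicinityP YQ).
  (* Beyond the digits of the first [k] branches, every directed branch has index at least [k]. *)
  exists (maxn (N b) (\max_(i < k) e b i).+1) => x [->|[m []]]; first by left.
  rewrite geq_max => /andP[Nm km] dm xm; right.
  have [_ eI'] := eP b; have [i _ im] : range (e b) m by rewrite eI'.
  exists i; last by rewrite /S im.
  rewrite leqNgt; apply/negP => ik.
  have := leq_bigmax (F := fun i : 'I_k => e b i) (Ordinal ik).
  by rewrite /= im; move: km; set M := (\max_(_ < _) _); lia.
move=> g [gc gK gP gS gid]; exists g; split=> //.
- exact: (gP false).
- move=> x nV; apply: gid => [[]|i b Sx]; [by move=> xq; rewrite xq in nV|by move=> xp; rewrite xp in nV|].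
  by apply: nV; case: (SO _ _ _ Sx).
- move=> x; have [[b xb]|np] := pselect (exists b, x = P b).
    have ZP c : Z (coord (P c)) by case: c.
    by rewrite xb gP; split.
  have [[[i b] /= Sx]|nS] := pselect (exists ib, S ib.1 ib.2 x).
    rewrite (gS _ _ _ Sx) coord_shift.
    have te := splice_tail_equiv (flip (coord (P (~~ b))) (e (~~ b) i))
      (e (~~ b) i).+1 (e b i).+1 (coord x).
    by split; apply: Zsat => //; exact: tail_equiv_sym.
  rewrite gid//; first by move=> b xb; apply: np; exists b.
  by move=> i b Sx; apply: nS; exists (i, b).
Qed.

End Shift.

Lemma countable_range T (A : set T) : countable A -> A !=set0 ->
  exists f : nat -> T, range f = A.
Proof.
move=> /countable_injP[i iinj] [a Aa].
have /choice[f fP] : forall n, exists x, A x /\ forall y, A y -> i y = n -> x = y.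
  move=> n; have [[x [Ax xn]]|nx] := pselect (exists x, A x /\ i x = n).
    exists x; split=> // y Ay yn; apply: iinj; rewrite ?inE//.
    by rewrite xn yn.
  by exists a; split=> // y Ay yn; case: nx; exists y.
exists f; apply/seteqP; split=> [_ [n _ <-]|x Ax]; first by have [] := fP n.
by exists (i x) => //; have [_ /(_ x Ax erefl)] := fP (i x).
Qed.

(** * Homogeneity and weight *)

Section ArrowSpace.
Variable Y : set cantor_space.
Hypotheses (YQ : Y `<=` ~` Qset).
Local Notation X := (arrow_space Y).

(** Finite words, padded with [false], name all cones; this makes the cones countable. *)
Lemma cone_mkseq x n :
  cone (Y := Y) (nth false (mkseq x n)) (size (mkseq x n)) = cone x n.
Proof.
by rewrite size_mkseq; apply/seteqP; split=> q qx i ni; rewrite qx// nth_mkseq.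
Qed.

Lemma cone_nonempty (s : seq bool) : cone (Y := Y) (nth false s) (size s) !=set0.
Proof.
have [|p [px _]] := @arrow_point Y (nth false s) true.
  by left; exists (size s) => m sm; rewrite nth_default.
by exists p => i _; rewrite px.
Qed.

Lemma arrow_separable : separable X.
Proof.
have /choice[d dP] := cone_nonempty.
exists (range d); first exact: card_le_trans (card_image_le _ _) (countableP _).
move=> O [p Op] oO.
have [n nO] := proj1 (nbhs_vicinityP YQ p O) (open_nbhs_nbhs (conj oO Op)).
(* Every neighbourhood contains a full branch, hence a cone, so one point per cone gives a dense
   set. *)
have [m nm dm] := directed_unbounded YQ p n.
pose s := mkseq (flip (coord p) m) m.+1; exists (d s); split; last by exists s.
apply: nO; right; exists m; split=> //; rewrite branch_cone -cone_mkseq.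
exact: dP.
Qed.

(** When [y] does not pass through the cone, the comparison with [y] is settled within the first [m]
    digits. *)
Lemma cut_cone y (p q : X) m : ~ (forall i, (i < m)%N -> y i = coord p i) ->
  cone (coord p) m q -> cut y q <-> cut y p.
Proof.
have half (r t : X) : ~ (forall i, (i < m)%N -> y i = coord r i) ->
    cone (coord r) m t -> cut y r -> cut y t.
  move=> yr tr [/cantor_ltP[k [ryk rk yk]]|[ry _]]; last by case: yr; rewrite ry.
  have km : (k < m)%N.
    rewrite ltnNge; apply/negP => mk; apply: yr => i im.
    by rewrite ryk// (leq_trans im).
  left; apply/cantor_ltP; exists k; split=> // [i ik|]; last by rewrite tr.
  by rewrite tr ?ryk// (ltn_trans ik).
move=> yp qp; split; [apply: half|exact: half].
- by move=> yq; apply: yp => i im; rewrite yq// qp.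
- by move=> i im; rewrite qp.
Qed.

Lemma lambda'_back_and_forth (d e : nat -> X) : saturated Y -> lambda'_set Y ->
  dense (range d) -> dense (range e) ->
  exists2 f : X -> X, homeomorphism f & f @` range d = range e.
Proof.
move=> Ysat Ylam dd de.
pose Z : set cantor_space := [set x | exists2 p, (range d `|` range e) p &
  tail_equiv (coord p) x].
have Zsat x y : tail_equiv x y -> Z x -> Z y.
  by move=> xy [p pP px]; exists p => //; exact: tail_equiv_trans px xy.
have Zd p : (range d `|` range e) p -> Z (coord p).
  by move=> pP; exists p => //; exists 0, 0.
have Zcount : countable Z.
  (* Each element of [Z] is a finite word followed by a tail of the coordinate of some [d k] or
     [e k]. *)
  pose f (t : (nat * bool) * (seq bool * nat)) := splice (nth false t.2.1)
    (size t.2.1) t.2.2 (coord (if t.1.2 then e t.1.1 else d t.1.1)).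
  apply: card_le_trans (_ : range f #<= _); last first.
    by apply: card_le_trans (card_image_le _ _) (countableP _).
  apply: subset_card_le => x [p pP [m [n px]]].
  have [t tp] : exists t : nat * bool, (if t.2 then e t.1 else d t.1) = p.
    by case: pP => -[k _ <-]; [exists (k, false)|exists (k, true)].
  exists (t, (mkseq x n, m)) => //; apply/funext => i; rewrite /f /splice /= tp size_mkseq.
  case: ltnP => [ni|ni]; first by rewrite nth_mkseq.
  by rewrite addnC px subnKC.
have [z zZ] : exists z : nat -> cantor_space, range z = Z.
  by apply: countable_range => //; exists (coord (d 0)); apply: Zd; left; exists 0.
have [G [O oO GO] ZG] := Ylam Z Zcount.
pose W : set X := [set p | Z (coord p)].
pose C n : set (set X) := [set A | (exists x, A = cone x n) \/
  (exists y, [/\ Y y, ~ O n y & A = cut y]) \/ (Y (z n) /\ A = cut (z n))].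
apply: (@back_and_forth X C W) => //.
- exact: arrow_compact.
- exact: order_hausdorff.
- move=> n A [[x ->]|[[y [Yy _ ->]]|[Yz ->]]]; first exact: cone_clopen.
    exact: cut_clopen.
  exact: cut_clopen.
- move=> p q pq; have pq1 : coord p = coord q.
    apply/funext => i; have [+ _] := pq i.+1 (cone (coord p) i.+1) (or_introl (ex_intro _ _ erefl)).
    by move=> /(_ (fun _ _ => erefl)) ->.
  have [Yp|/same_coord] := pselect (Y (coord p)); last by apply.
  (* Every cut over [Y] appears at some level: elements of [Z] through the enumeration [z], the
     others because they lie outside [G], hence outside some [O n]. *)
  have [n Cn] : exists n, C n (cut (coord p)).
    have [Zp|nZ] := pselect (Z (coord p)).
      have [n _ zn] : range z (coord p) by rewrite zZ.
      by exists n; right; right; rewrite zn.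
    have nG : ~ G (coord p).
      by move=> Gp; apply: nZ; rewrite ZG; split=> //; left.
    have /existsNP[n nO] : ~ forall n, O n (coord p).
      by move=> Op; apply: nG; rewrite GO => n _; exact: Op.
    by exists n; right; left; exists (coord p).
  apply: arrow_inj => //; have := pq n _ Cn.
  rewrite (@cut_upper Y p p erefl) (@cut_upper Y p q (esym pq1)).
  by case: (upper p) (upper q) => -[] // [a b]; [have := b isT|have := a isT].
- move=> n p Wp; have Op : nbhs (coord p) (O n).
    apply: open_nbhs_nbhs; split=> //.
    by move: Wp; rewrite /W /= ZG GO => -[_]; apply.
  (* An element outside [O n] shares no prefix of length [m] with [coord p], so by [cut_cone] its
     cut does not split the cone. Only the cut at [z n] remains, and [B] takes care of it. *)
  have [m mO] := cantor_nbhsP Op.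
  pose B := [set q : X | Y (z n) -> cut (z n) q <-> cut (z n) p].
  have pB : nbhs p B.
    have [Yz|nY] := pselect (Y (z n)); last first.
      by have -> : B = setT by [apply/seteqP]; exact: filterT.
    have [oc oC] := cut_openP YQ Yz; have [pc|npc] := pselect (cut (z n) p).
      by apply: filterS (open_nbhs_nbhs (conj oc pc)) => q.
    by apply: filterS (open_nbhs_nbhs (conj oC npc)) => q.
  exists (cone (coord p) (maxn n m) `&` B).
    by apply: filterI => //; exact: nbhs_cone.
  move=> A CA; suff AP q : (cone (coord p) (maxn n m) `&` B) q -> A q <-> A p.
    by have [Ap|nAp] := pselect (A p); [left|right] => q qU; [apply/(AP q qU)|move/(AP q qU)].
  move=> [qp qB]; have qm i : (i < m)%N -> coord q i = coord p i.
    by move=> im; apply: qp; rewrite leq_max im orbT.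
  have qn i : (i < n)%N -> coord q i = coord p i.
    by move=> ni; apply: qp; rewrite leq_max ni.
  case: CA => [[x ->]|[[y [Yy nOy ->]]|[Yz ->]]].
  + by split=> H i ni; rewrite -H// qn.
  + by apply: (@cut_cone y p q m) => // /mO.
  + exact: qB.
- by move=> p q V Wp Wq oV Vp Vq; exact: (arrow_swap YQ Ysat Zsat).
- by move=> p pd; apply: Zd; left.
- by move=> p pe; apply: Zd; right.
Qed.

Lemma arrow_cdh : saturated Y -> lambda'_set Y -> countable_dense_homogeneous X.
Proof.
move=> Ysat Ylam; split; first exact: arrow_separable.
have enum (D : set X) : countable D -> dense D -> exists d : nat -> X, range d = D.
  move=> Dc Dd; apply: countable_range => //.
  have [p _] := cone_nonempty [::].
  by have [q [_ Dq]] := Dd setT (ex_intro _ p I) openT; exists q.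
move=> D E Dc Dd Ec Ed; have [d dD] := enum D Dc Dd; have [e eE] := enum E Ec Ed.
by rewrite -dD -eE; apply: lambda'_back_and_forth; rewrite ?dD ?eE.
Qed.

Lemma le_card_basis (B : set (set X)) : basis B -> Y #<= B.
Proof.
move=> [Bo Bb].
have /choice[u uP] : forall y, exists U : set X, Y y ->
    [/\ B U, (exists p, [/\ U p, coord p = y & upper p = false]) & U `<=` cut y].
  move=> y; have [Yy|nY] := pselect (Y y); last by exists set0.
  have [p [py pF]] := @arrow_point Y y false (@Y_Qtail _ YQ y false Yy).
  have py' : cut y p by right; rewrite pF.
  have [U [BU Up] Uy] := Bb p _ (open_nbhs_nbhs (conj (proj1 (cut_openP YQ Yy)) py')).
  by exists U => _; split=> //; exists p.
(* (y, 0) is the largest element of [u y]. *)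
have uinj : {in Y &, injective u}.
  have lt x y : Y x -> Y y -> u x = u y -> ~ (x < y)%O.
    move=> Yx Yy uxy xy; have [_ _ ux] := uP x Yx.
    have [_ [p [+ py _]] _] := uP y Yy; rewrite -uxy => /ux[|[px _]].
      by rewrite py => /(lt_trans xy); rewrite ltxx.
    by move: xy; rewrite -py px ltxx.
  move=> x y; rewrite !inE => Yx Yy uxy.
  by have [/lt|/lt|//] := ltgtP x y; case.
apply: card_le_trans (_ : u @` Y #<= B).
  by have /card_eqPle[] : u @` Y #= Y by exact: inj_card_eq.
by apply: subset_card_le => _ [y Yy <-]; have [] := uP y Yy.
Qed.

(** Bounds by [Y] the cardinality of a base indexed by countably many shapes for each element of
    [Y]. *)
Lemma nat_times_saturated_card : saturated Y -> [set: nat] `*` Y #<= Y.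
Proof.
move=> Ysat.
(* (n, y) is coded as 1^n 0 y. *)
pose c (t : nat * cantor_space) := splice (fun i => i < t.1)%N t.1.+1 0 t.2.
have cinj : injective c.
  have lt s t : c s = c t -> ~ (s.1 < t.1)%N.
    move=> /(congr1 (fun x : cantor_space => x s.1)) + st.
    by rewrite /c /splice ltnSn ltnn ltnS (ltnW st) st.
  move=> [m x] [n y] cc; have mn : m = n.
    by have [/(lt (m, x) (n, y) cc)|/(lt (n, y) (m, x) (esym cc))|] := ltngtP m n.
  rewrite mn in cc *; congr pair; apply/funext => i.
  have := congr1 (fun x : cantor_space => x (n.+1 + i)%N) cc.
  by rewrite /c /splice /= ltnNge leq_addr /= addn0 addKn.
apply: card_le_trans (_ : c @` ([set: nat] `*` Y) #<= Y).
  by have /card_eqPle[] : c @` ([set: nat] `*` Y) #= [set: nat] `*` Y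
    by apply: inj_card_eq => s t _ _; exact: cinj.
apply: subset_card_le => _ [[n y] [_ Yy] <-].
by apply: saturatedP Yy => //; apply/tail_equiv_sym/splice_tail_equiv.
Qed.

(** Cones, alone or halved by a cut, form a base. For empty [Y] the space is still nonempty and has
    no empty base, hence the hypothesis [Y !=set0]. *)
Lemma arrow_weight : saturated Y -> Y !=set0 -> weight_eq X Y.
Proof.
move=> Ysat [y0 Yy0]; split; last exact: le_card_basis.
pose base (t : (seq bool * option bool) * cantor_space) : set X :=
  cone (nth false t.1.1) (size t.1.1) `&`
  if t.1.2 is Some b then if b then cut t.2 else ~` cut t.2 else setT.
(* Numbers coding no shape give the harmless open set [setT]. *)
pose b (t : nat * cantor_space) :=
  if choice.unpickle t.1 is Some s then base (s, t.2) else setT.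
pose B := b @` ([set: nat] `*` Y).
suff Bb : basis B.
  exists B => //; rewrite card_eq_le le_card_basis// andbT.
  exact: card_le_trans (card_image_le _ _) (nat_times_saturated_card Ysat).
have Bbase s y : Y y -> B (base (s, y)).
  by move=> Yy; exists (choice.pickle s, y) => //; rewrite /b /= choice.pickleK.
split=> [_ [[n y] [_ Yy] <-]|p U].
  rewrite /b /=; case: choice.unpickle => [[s f]|]; last exact: openT.
  apply: openI; first exact: cone_open.
  by have [? ?] := cut_openP YQ Yy; case: f => [[]|] //; exact: openT.
move=> /(nbhs_vicinityP YQ)[n nU].
have [Yp|nY] := pselect (Y (coord p)); last first.
  (* With [None] the second component is ignored, so [y0] is only a placeholder index. *)
  exists (base ((mkseq (coord p) n, None), y0)).
    by split; [exact: Bbase|split=> //=; rewrite cone_mkseq].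
  move=> q [/=]; rewrite cone_mkseq => qp _.
  by apply: nU; exact: cone_cut_vicinity.
have [pc|pc] := pselect (cut (coord p) p).
  exists (base ((mkseq (coord p) n, Some true), coord p)).
    by split; [exact: Bbase|split=> //=; rewrite cone_mkseq].
  move=> q [/=]; rewrite cone_mkseq => qp qc.
  by apply: nU; exact: cone_cut_vicinity.
exists (base ((mkseq (coord p) n, Some false), coord p)).
  by split; [exact: Bbase|split=> //=; rewrite cone_mkseq].
move=> q [/=]; rewrite cone_mkseq => qp qc.
by apply: nU; exact: cone_cut_vicinity.
Qed.

End ArrowSpace.

Theorem theorem5p5 (Y : set cantor_space) (hYQ : Y `<=` ~` Qset)
    (hYsat : saturated Y) (hYlambda : lambda'_set Y) :
  [/\ compact [set: arrow_space Y],
      linearly_ordered_space (arrow_space Y),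
      countable_dense_homogeneous (arrow_space Y) &
      Y !=set0 -> weight_eq (arrow_space Y) Y].
Proof.
split.
- exact: arrow_compact.
- exact: order_topological_linearly_ordered.
- exact: arrow_cdh.
- exact: arrow_weight.
Qed.
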